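(* Let $n\ge 2$ be an integer, let $H$ be an $n$-uniform hypergraph on a finite vertex set $V$, and let $G$ be a group of order $n$. If every $G$-equivariant linear map $B(H)\to\mathbb{C}^\perp[G]$ has a zero, then for every map $c\colon V\to G$ there is a hyperedge $e\in H$ and an ordering $e=\{v_1,\dots,v_n\}$ of its vertices with $c(v_1)c(v_2)\cdots c(v_n)=1$.
   Context: $G$ is written multiplicatively with identity $1$. $B(H)$ is the simplicial complex on vertex set $V\times G$ in which $\bigcup_{g\in G}(A_g\times\{g\})$ (with $A_g\subseteq V$) is a face iff $\{a_g: g\in G\}\in H$ for every choice $a_g\in A_g$, $g\in G$; $G$ acts on it (freely) via $g\cdot(v,g')=(v,gg')$ on vertices, extended to the geometric realization. $\mathbb{C}[G]=\{\sum_{g}z_g\,g: z_g\in\mathbb{C}\}$ is the complex regular representation, with $G$ acting by linearly extending left multiplication, and $\mathbb{C}^\perp[G]=\{\sum_g z_g\,g:\sum_g z_g=0\}$. A linear map $B(H)\to\mathbb{C}^\perp[G]$ is a map on the geometric realization that is affine on each simplex (determined by vertex images via linear interpolation); a zero is a point mapped to $0$. *)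

(* Defs.v *)
From HB Require Import structures.
From mathcomp Require Import all_boot all_order all_algebra all_fingroup.
From mathcomp Require Import reals complex.

Set Implicit Arguments.
Unset Strict Implicit.
Unset Printing Implicit Defensive.

Import Order.TTheory GRing.Theory Num.Theory.
Local Open Scope ring_scope.
Local Open Scope complex_scope.

Section FormalSums.

Variables (K : pzRingType) (T : finType).

(* A function [x : {ffun T -> K}] stands for the formal sum
   [\sum_t (x t) t]; [basis t] is the formal sum reduced to [t]. *)
Definition basis (t : T) : {ffun T -> K} := [ffun s => (s == t)%:R].

(* Sends [\sum_t (x t) t] to [\sum_t (x t) (phi t)]. *)
Definition linear_ext (phi : T -> T) (x : {ffun T -> K}) : {ffun T -> K} :=
  [ffun s => \sum_(t | phi t == s) x t].

Lemma linear_ext_basis phi t : linear_ext phi (basis t) = basis (phi t).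
Proof.
apply/ffunP => s; rewrite !ffunE; case: (eqVneq s (phi t)) => [->|ns].
  rewrite (bigD1 t)//= ffunE eqxx big1 ?addr0// => u /andP[_ /negPf ut].
  by rewrite ffunE ut.
rewrite big1// => u /eqP us; rewrite ffunE; case: eqP => // ut.
by rewrite -us ut eqxx in ns.
Qed.

Lemma linear_extE phi x t : injective phi -> linear_ext phi x (phi t) = x t.
Proof.
by move=> phiI; rewrite ffunE (big_pred1 t)// => u; rewrite (inj_eq phiI).
Qed.

End FormalSums.

Section Realization.

Variables (R : realType) (T : finType) (K : {set {set T}}).

(* Points of the geometric realization of [K] are given by their barycentric
   coordinates, so that a vertex [t] is the point [basis R t]. *)
Definition realization : {pred {ffun T -> R}} :=
  [pred x : {ffun T -> R} | [&& [forall t, 0 <= x t], \sum_t x t == 1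
                              & [set t | x t != 0] \in K]].

(* A map on the realization is encoded by a total function of the coordinates;
   only its values on the realization matter. *)
Definition linear_on_simplices (G : finType)
    (f : {ffun T -> R} -> {ffun G -> R[i]}) : Prop :=
  {in realization, forall x h,
    f x h = \sum_t (x t)%:C * f (basis R t) h}.

Lemma basis_realization t : [set t] \in K -> basis R t \in realization.
Proof.
move=> tK; apply/and3P; split.
- by apply/forallP => s; rewrite ffunE ler0n.
- rewrite (bigD1 t)//= ffunE eqxx big1 ?addr0// => u /negPf ut.
  by rewrite ffunE ut.
- suff -> : [set s | basis R t s != 0] = [set t] by [].
  by apply/setP => s; rewrite !inE ffunE; case: (s == t); rewrite ?eqxx ?oner_eq0.
Qed.

End Realization.

Arguments realization R {T} K.

Section BoxComplex.

Variables (V : finType) (G : finGroupType) (H : {set {set V}}).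

(* Here [A_g = [set v | (v, g) \in A]]. No choice function exists when some
   [A_g] is empty, so every such [A] is a face. *)
Definition box_complex : {set {set V * G}} :=
  [set A : {set V * G} | [forall a : {ffun G -> V},
    [forall g, (a g, g) \in A] ==> ([set a g | g : G] \in H)]].

Definition box_act (g : G) (w : V * G) : V * G := (w.1, (g * w.2)%g).

Definition box_point_act (R : realType) (g : G) :
    {ffun V * G -> R} -> {ffun V * G -> R} :=
  linear_ext (box_act g).

Lemma box_act_inj g : injective (box_act g).
Proof. by case=> v h [w k] [-> /mulgI ->]. Qed.

Lemma box_complex_sub (A B : {set V * G}) :
  A \subset B -> B \in box_complex -> A \in box_complex.
Proof.
move=> AB; rewrite !inE => /forallP BH; apply/forallP => a.
apply/implyP => /forallP aA; apply: (implyP (BH a)).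
by apply/forallP => g; apply: (subsetP AB).
Qed.

Lemma box_complex_vertex w : (1 < #|G|)%N -> [set w] \in box_complex.
Proof.
move=> G1; rewrite inE; apply/forallP => a; apply/implyP => /forallP aw.
suff : (#|G| <= 1)%N by rewrite leqNgt G1.
rewrite -(card1 w.2); apply/subset_leq_card/subsetP => g _.
by have := aw g; rewrite !inE => /eqP <-.
Qed.

Lemma box_point_act_realization (R : realType) g x :
  x \in realization R box_complex ->
  box_point_act g x \in realization R box_complex.
Proof.
have gI := @box_act_inj g.
have gE w : w = box_act g (box_act g^-1%g w).
  by case: w => v h; rewrite /box_act /= mulKVg.
case/and3P => /forallP x0 /eqP x1 xB; apply/and3P; split.
- by apply/forallP => w; rewrite (gE w) linear_extE.
- rewrite (reindex (box_act g)) /=; last first.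
    by exists (box_act g^-1%g) => -[v h] _; rewrite /box_act /= ?mulKg ?mulKVg.
  by rewrite -x1; apply/eqP/eq_bigr => w _; rewrite linear_extE.
- move: xB; rewrite !inE => /forallP xB; apply/forallP => a.
  apply/implyP => /forallP aB.
  suff -> : [set a h | h : G] = [set [ffun h => a (g * h)%g] h | h : G].
    apply: (implyP (xB _)); apply/forallP => h; rewrite inE ffunE.
    by have := aB (g * h)%g; rewrite inE -[(_, _)]/(box_act g (_, h)) linear_extE.
  apply/setP => v; apply/imsetP/imsetP => -[h _ ->].
    by exists (g^-1 * h)%g; rewrite ?ffunE ?mulKVg.
  by exists (g * h)%g; rewrite ?ffunE.
Qed.

End BoxComplex.

Section RegularRepresentation.

Variables (R : realType) (G : finGroupType).

Definition regular_act (g : G) : {ffun G -> R[i]} -> {ffun G -> R[i]} :=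
  linear_ext (fun h => (g * h)%g).

Definition Cperp : {pred {ffun G -> R[i]}} :=
  [pred z : {ffun G -> R[i]} | \sum_g z g == 0].

Variables (V : finType) (H : {set {set V}}).

Definition equivariant_linear_map
    (f : {ffun V * G -> R} -> {ffun G -> R[i]}) : Prop :=
  [/\ {in realization R (box_complex G H), forall x, f x \in Cperp},
      linear_on_simplices (box_complex G H) f
    & forall g, {in realization R (box_complex G H), forall x,
        f (box_point_act g x) = regular_act g (f x)}].

End RegularRepresentation.

(* Main.v *)
Require Import Defs.
From HB Require Import structures.
From mathcomp Require Import all_boot all_order all_algebra all_fingroup.
From mathcomp Require Import reals complex.

(** The vertex map [(v, g) |-> g + 'i (g c(v))], minus the average
    [1/n \sum_h (h + 'i h)], is equivariant.  At a zero [x] of its linear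
    extension, the real part says that the weights of [x] on each layer
    [V * {g}] sum to [1/n], and the imaginary part that so do the weights on
    each level set [g c(v) = h].  Hence the matrix of total weights over
    [(g, g c(v))] is a multiple of a doubly stochastic one, and Hall's theorem
    yields a permutation [p] of [G] and [(a_g, g)] in the support of [x] with
    [g c(a_g) = p(g)].  Now [{a_g}] is a hyperedge, and the
    [c(a_g) = g^-1 p(g)] telescope to [1] along each cycle of [p]. *)


Set Implicit Arguments.
Unset Strict Implicit.
Unset Printing Implicit Defensive.

Import Order.TTheory GRing.Theory Num.Theory.
Local Open Scope ring_scope.

Local Open Scope complex_scope.

(** Induction on [#|A|]. If a nonempty proper subset [B] is tight, meaning that it has exactly
    [#|B|] neighbours, then [B] and its complement are matched separately, the latter outside the
    neighbours of [B]. Otherwise any [a] takes any neighbour [u], and the rest is matched without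
    [u]. The point [u0] is a default value for empty [A]. *)
Lemma hall_marriage (T U : finType) (u0 : U) (r : T -> {set U}) (A : {set T}) :
  (forall B : {set T}, B \subset A -> #|B| <= #|\bigcup_(t in B) r t|)%N ->
  exists2 f : T -> U, {in A &, injective f} & {in A, forall t, f t \in r t}.
Proof.
have [k] := ubnP #|A|; elim: k => // k IH in r A * => /ltnSE Ak hallA.
have [->|[a aA]] := set_0Vmem A.
  by exists (fun=> u0) => [x y|x]; rewrite inE.
have [/existsP[B /and4P[BA B0 AB tightB]]|/existsPn loose] := boolP
  [exists B : {set T},
    [&& B \subset A, B != set0, B != A & #|\bigcup_(t in B) r t| == #|B|]].
- set NB := \bigcup_(t in B) r t in tightB.
  have ltBA : (#|B| < #|A|)%N by rewrite proper_card// properEneq AB.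
  have [||f fI fr] := IH r B; first exact: leq_trans Ak.
    by move=> C CB; apply: hallA; apply: subset_trans BA.
  have [||h hI hr] := IH (fun t => r t :\: NB) (A :\: B).
  + rewrite cardsD (setIidPr BA); apply: leq_trans Ak.
    by rewrite ltn_subrL card_gt0 B0 (leq_ltn_trans _ ltBA).
  + move=> C; rewrite subsetD => /andP[CA dCB].
    (* Hall's condition for the disjoint union of [C] and [B], less the tight equality for [B],
       gives the condition for [C] outside [NB]. *)
    have := hallA (C :|: B); rewrite subUset CA BA => /(_ isT).
    rewrite bigcup_setU cardsU (disjoint_setI0 dCB) cards0 subn0 => le.
    have -> : \bigcup_(t in C) (r t :\: NB) = (\bigcup_(t in C) r t) :\: NB.
      by rewrite setDE big_distrl; apply: eq_bigr => t _; rewrite setDE.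
    rewrite -(leq_add2r #|B|) -{2}(eqP tightB) (leq_trans le)//.
    by rewrite cardsU cardsD -addnBAC// subset_leq_card// subsetIl.
  exists (fun t => if t \in B then f t else h t) => [x y xA yA|x xA] /=.
  + case: ifPn => xB; case: ifPn => yB; [exact: fI| | |].
    * move=> fh; have := hr y; rewrite !inE yB yA => /(_ isT)/andP[/bigcupP[]].
      by exists x => //; rewrite -fh fr.
    * move=> hf; have := hr x; rewrite !inE xB xA => /(_ isT)/andP[/bigcupP[]].
      by exists y => //; rewrite hf fr.
    * by apply: hI; rewrite inE ?xB ?yB.
  + case: ifPn => xB; first exact: fr.
    by have := hr x; rewrite !inE xB xA => /(_ isT)/andP[].
- have /card_gt0P[u ura] : (0 < #|r a|)%N.
    by have := hallA [set a]; rewrite sub1set aA cards1 big_set1 => /(_ isT).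
  have [||h hI hr] := IH (fun t => r t :\ u) (A :\ a).
  + by move: Ak; rewrite (cardsD1 a A) aA.
  + move=> C CA; have [->|C0] := eqVneq C set0; first by rewrite cards0.
    have CA' : C \subset A by apply: subset_trans CA (subsetDl _ _).
    have CnA : C != A.
      by apply: contraTneq CA => ->; apply/subsetPn; exists a; rewrite ?inE ?eqxx.
    have -> : \bigcup_(t in C) (r t :\ u) = (\bigcup_(t in C) r t) :\ u.
      by rewrite setDE big_distrl; apply: eq_bigr => t _; rewrite setDE.
    have := loose C; rewrite CA' C0 CnA /= => Cloose.
    (* Without tight sets the inequality is strict, which pays for the loss of [u]. *)
    have : (#|C| < #|\bigcup_(t in C) r t|)%N.
      by rewrite ltn_neqAle eq_sym Cloose hallA.
    by rewrite (cardsD1 u (\bigcup_(t in C) r t)); case: (_ \in _) => //= /ltnW.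
  exists (fun t => if t == a then u else h t) => [x y xA yA|x xA] /=.
  + case: eqVneq => [->|xa]; case: eqVneq => [->|ya] //.
    * move=> uh; have := hr y; rewrite !inE ya yA => /(_ isT)/andP[].
      by rewrite -uh eqxx.
    * move=> hu; have := hr x; rewrite !inE xa xA => /(_ isT)/andP[].
      by rewrite hu eqxx.
    * by apply: hI; rewrite !inE ?xa ?ya.
  + case: eqVneq => [->//|xa].
    by have := hr x; rewrite !inE xa xA => /(_ isT)/andP[].
Qed.

Lemma doubly_stochastic_matching (R : realFieldType) (G : finType) (s : R)
    (M : G -> G -> R) :
  0 < s -> (forall g h, 0 <= M g h) ->
  (forall g, \sum_h M g h = s) -> (forall h, \sum_g M g h = s) ->
  exists2 p : G -> G, injective p & forall g, M g (p g) != 0.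
Proof.
move=> s0 M0 rowM colM.
have [g0 _|G0] := pickP (pred_of_simpl (@predT G)); last first.
  by exists id => [//|g]; have := G0 g.
have [|p pI pM] := @hall_marriage G G g0 (fun g => [set h | M g h != 0]) setT.
  move=> B _; set N := \bigcup_(g in B) _.
  (* Double counting: the rows in [B] have total mass [s * #|B|], all of it in the columns of [N],
     whose total mass is [s * #|N|]. *)
  rewrite -(ler_nat R) -(ler_pM2l s0) !mulr_natr -!sumr_const.
  rewrite -(eq_bigr _ (fun g _ => rowM g)) -(eq_bigr _ (fun h _ => colM h)).
  rewrite [leRHS]exchange_big /=; apply: (@le_trans _ _
    (\sum_(g in B) \sum_(h in N) M g h)); last first.
    rewrite [leRHS](bigID (mem B)) /= lerDl.
    by apply: sumr_ge0 => g _; apply: sumr_ge0.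
  apply: ler_sum => g gB; rewrite (bigID (mem N)) /= gerDl.
  rewrite big1// => h hN; apply/eqP; apply: contraNT hN => Mgh.
  by apply/bigcupP; exists g; rewrite ?inE.
exists p => [x y|g]; first by apply: pI; rewrite inE.
by have := pM g; rewrite !inE => /(_ isT).
Qed.

Lemma prod_traject (G : finGroupType) (p : G -> G) (x : G) (k : nat) :
  (\prod_(g <- traject p x k) (g^-1 * p g) = x^-1 * iter k p x)%g.
Proof.
elim: k x => [|k IH] x; first by rewrite big_nil mulVg.
by rewrite big_cons IH iterSr -mulgA mulKVg.
Qed.

(** [G] need not be commutative, so the order of the factors matters: [l] lists the cycles of [p]
    one after another, each in cyclic order, and the product over each cycle telescopes to 1. *)
Lemma prod_divg_perm (G : finGroupType) (p : G -> G) : injective p ->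
  exists l : seq G,
    [/\ uniq l, l =i G & (\prod_(g <- l) (g^-1 * p g) = 1)%g].
Proof.
(* Generalized to [p]-closed sets, so that the induction can remove one orbit at a time. *)
move=> pI; suff closed_case k (A : {set G}) : (#|A| < k)%N -> fclosed p A ->
    exists l : seq G,
      [/\ uniq l, l =i A & (\prod_(g <- l) (g^-1 * p g) = 1)%g].
  have [//|l [lU lT l1]] := closed_case _ [set: G] (ltnSn _).
  - by move=> x y _; rewrite !inE.
  - by exists l; split=> // g; rewrite lT inE.
elim: k A => // k IH A /ltnSE Ak Acl.
have [->|[x xA]] := set_0Vmem A.
  by exists [::]; split=> // [g|]; rewrite ?inE// big_nil.
have orbitA y : y \in fingraph.orbit p x -> y \in A.
  by rewrite -fconnect_orbit => /(closed_connect Acl) <-.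
have [||l [lU lE l1]] := IH (A :\: [set y in fingraph.orbit p x]).
- apply: leq_trans Ak; apply/proper_card/properP; split; first exact: subsetDl.
  by exists x => //; rewrite !inE in_orbit.
- move=> y z yz; rewrite !inE -(Acl _ _ yz) -!fconnect_orbit.
  by rewrite (same_connect_r (fconnect_sym pI) (connect1 yz)).
exists (fingraph.orbit p x ++ l); split.
- rewrite cat_uniq orbit_uniq lU andbT; apply/hasPn => y.
  by rewrite lE !inE => /andP[].
- move=> y; rewrite mem_cat lE !inE; case: (boolP (y \in fingraph.orbit p x)) => //=.
  by move=> /orbitA ->.
- by rewrite big_cat /= l1 mulg1 prod_traject iter_order// mulVg.
Qed.

Section Deviation.

Variables (R : realType) (T : finType) (G : finGroupType).
Implicit Types (phi : T -> G) (x : {ffun T -> R}) (h : G).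

(* The [h]-coefficient of
   [\sum_t (x t) (phi t - #|G|^-1 \sum_(h : G) h)]. *)
Definition deviation phi x h : R :=
  \sum_t x t * ((phi t == h)%:R - #|G|%:R^-1).

Lemma sum_deviation phi x : \sum_h deviation phi x h = 0.
Proof.
rewrite exchange_big big1//= => t _; rewrite -mulr_sumr sumrB sumr_const.
rewrite (bigD1 (phi t))//= eqxx big1 => [|h /negPf]; last first.
  by rewrite eq_sym => ->.
rewrite addr0 -[_^-1 *+ _]mulr_natr mulVf ?subrr ?mulr0// pnatr_eq0 -lt0n.
by apply/card_gt0P; exists 1%g.
Qed.

Lemma deviation_basis phi t h :
  deviation phi (basis R t) h = (phi t == h)%:R - #|G|%:R^-1.
Proof.
rewrite /deviation (bigD1 t)//= ffunE eqxx mul1r big1 ?addr0// => s /negPf st.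
by rewrite ffunE st mul0r.
Qed.

Lemma deviation_equivariant phi (act : T -> T) g x h :
  injective act -> (forall t, phi (act t) = g * phi t)%g ->
  deviation phi (linear_ext act x) h = deviation phi x (g^-1 * h)%g.
Proof.
move=> actI phiE; rewrite /deviation (reindex act) /=; last first.
  exact/onW_bij/injF_bij.
apply: eq_bigr => t _; rewrite linear_extE// phiE.
by rewrite -(inj_eq (mulgI g^-1%g)) mulKg.
Qed.

(** Since [x] has total weight 1, the subtracted average contributes exactly [#|G|%:R^-1]. *)
Lemma deviation_eq0 phi x h : \sum_t x t = 1 -> deviation phi x h = 0 ->
  \sum_(t | phi t == h) x t = #|G|%:R^-1.
Proof.
move=> x1 /eqP; rewrite /deviation; under eq_bigr do rewrite mulrBr.
rewrite sumrB -mulr_suml x1 mul1r subr_eq0 => /eqP <-.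
by rewrite big_mkcond; apply: eq_bigr => t _; case: eqP; rewrite ?mulr1 ?mulr0.
Qed.

End Deviation.

Section ColouringMap.

Variables (R : realType) (V : finType) (G : finGroupType) (c : V -> G).

(** The colour multiplies on the right, so that [twist] commutes with the left action of [G]. *)
Definition twist (w : V * G) : G := (w.2 * c w.1)%g.

Definition colouring_map (x : {ffun V * G -> R}) : {ffun G -> R[i]} :=
  [ffun h => deviation snd x h +i* deviation twist x h].

Lemma colouring_map_equivariant_linear (H : {set {set V}}) :
  equivariant_linear_map H colouring_map.
Proof.
split.
- move=> x _; rewrite inE; under eq_bigr do rewrite ffunE.
  by rewrite eq_complex !raddf_sum /= !sum_deviation !eqxx.
- move=> x _ h; apply/eqP; rewrite ffunE eq_complex !raddf_sum /=.
  apply/andP; split; apply/eqP/eq_bigr => w _; rewrite ffunE /=.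
    by rewrite mul0r subr0 deviation_basis.
  by rewrite mul0r addr0 deviation_basis.
- move=> g x _; apply/ffunP => h; rewrite -[h in RHS](mulKVg g).
  rewrite linear_extE; last exact: mulgI.
  rewrite !ffunE !(@deviation_equivariant _ _ _ _ _ g) //; try exact: box_act_inj.
  by move=> w; rewrite /twist mulgA.
Qed.

(** The permutation found by the matching is [g * c (a g)] itself, so its injectivity is all that
    has to be recorded. *)
Lemma colouring_map_zero_transversal (H : {set {set V}})
    (x : {ffun V * G -> R}) :
  x \in realization R (box_complex G H) -> colouring_map x = 0 ->
  exists a : {ffun G -> V},
    [set a g | g : G] \in H /\ injective (fun g => g * c (a g))%g.
Proof.
case/and3P => /forallP x0 /eqP x1 xH fx0.
have dev0 h : deviation snd x h = 0 /\ deviation twist x h = 0.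
  by have := congr1 (fun z : {ffun G -> R[i]} => z h) fx0; rewrite !ffunE => -[].
(* The real part of the zero controls the row sums of [M], the imaginary part its column sums. *)
pose M g h := \sum_(w | (w.2 == g) && (twist w == h)) x w.
have [||||p pI pM] := @doubly_stochastic_matching R G #|G|%:R^-1 M.
- by rewrite invr_gt0 ltr0n; apply/card_gt0P; exists 1%g.
- by move=> g h; apply: sumr_ge0.
- move=> g; rewrite -(deviation_eq0 x1 (dev0 g).1).
  by rewrite [RHS](partition_big twist predT).
- move=> h; rewrite -(deviation_eq0 x1 (dev0 h).2).
  rewrite [RHS](partition_big snd predT)//=.
  by apply: eq_bigr => g _; apply: eq_bigl => w; rewrite andbC.
have /fin_all_exists[a aP] g : exists v, x (v, g) != 0 /\ (g * c v = p g)%g.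
  have /existsP[[v k] /and3P[/= /eqP <- /eqP <- xv]] : [exists w,
      [&& w.2 == g, twist w == p g & x w != 0]].
    apply: contraNT (pM g) => /existsPn no; apply/eqP/big1 => w /andP[wg wp].
    by apply/eqP; have := no w; rewrite wg wp /= negbK.
  by exists v.
exists (finfun a); split.
  (* The support of [x] is a face and [a] chooses one of its vertices in each layer. *)
  move: xH; rewrite inE => /forallP/(_ (finfun a))/implyP; apply.
  by apply/forallP => g; rewrite inE ffunE (aP g).1.
by move=> g h; rewrite /= !ffunE !(aP _).2; apply: pI.
Qed.

End ColouringMap.

Theorem theorem3p1 (R : realType) (n : nat) (V : finType) (H : {set {set V}})
    (G : finGroupType)
    (n_ge2 : (2 <= n)%N)
    (H_uniform : forall e : {set V}, e \in H -> #|e| = n)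
    (card_G : #|G| = n)
    (has_zero : forall f : {ffun V * G -> R} -> {ffun G -> R[i]%C},
       equivariant_linear_map H f ->
       exists2 x, x \in realization R (box_complex G H) & f x = 0)
    (c : V -> G) :
  exists2 e : {set V}, e \in H &
    exists v : n.-tuple V,
      [/\ uniq v, e = [set u in v] & (\prod_(i < n) c (tnth v i))%g = 1%g].
Proof.
have [x xB fx0] := has_zero _ (colouring_map_equivariant_linear R c H).
have [a [eH pI]] := colouring_map_zero_transversal xB fx0.
(* By uniformity the hyperedge has as many vertices as [G] has elements, so [a] repeats none. *)
have /imset_injP aI : #|[set a g | g in G]| == #|G|.
  by rewrite (H_uniform _ eH) card_G.
have [l [lU lG l1]] := prod_divg_perm pI.
have vS : size (map a l) == n.
  by rewrite size_map -card_G -(card_uniqP lU); apply/eqP/eq_card.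
exists [set a g | g : G] => //; exists (Tuple vS); split.
- by rewrite map_inj_in_uniq // => g h _ _; apply: aI.
- apply/setP => u; rewrite inE; apply/imsetP/mapP => -[g _ ->];
    by exists g; rewrite ?lG.
- rewrite -(big_tuple _ _ (Tuple vS) xpredT c) big_map -[RHS]l1.
  (* With [p g = g * c (a g)], the factor [g^-1 * p g] is the colour of [a g]. *)
  by apply: eq_bigr => g _; rewrite mulKg.
Qed.
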